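(* Let $n\geq 3$ and $1\leq r\leq n-2$ be integers. For every $G_n\in HL_n$, we have $sm_\lambda^r(G_n)=2^r(n-r)-n$.
   Context: Hypercube-like networks (HL-networks) are defined recursively: $HL_0=\{K_1\}$ (a single vertex), and for $n\geq 1$, $HL_n$ is the set of all graphs $G_{n-1}\oplus G'_{n-1}$ with $G_{n-1},G'_{n-1}\in HL_{n-1}$, where $G_{n-1}\oplus G'_{n-1}$ denotes the graph obtained from the disjoint union of $G_{n-1}$ and $G'_{n-1}$ by adding the edges of an arbitrary perfect matching between $V(G_{n-1})$ and $V(G'_{n-1})$ (i.e. the edges $\{x,\phi(x)\}$ for some bijection $\phi:V(G_{n-1})\to V(G'_{n-1})$). Every $G_n\in HL_n$ is an $n$-regular graph on $2^n$ vertices. A connected graph $G$ is strongly Menger edge connected (SM-$\lambda$) if for every pair of distinct vertices $u,v$ of $G$ there are $\min\{\deg_G(u),\deg_G(v)\}$ pairwise edge-disjoint $u$,$v$-paths in $G$. For a graph $G$ and integer $r\geq 0$, $sm_\lambda^r(G)$ is the maximum integer $m$ such that for every edge subset $F\subseteq E(G)$ with $|F|\leq m$ and $\delta(G-F)\geq r$ (where $\delta$ denotes minimum degree), the graph $G-F$ is SM-$\lambda$. *)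

(* Defs.v *)
From mathcomp Require Import all_boot all_order all_algebra.

Set Implicit Arguments.
Unset Strict Implicit.
Unset Printing Implicit Defensive.

Import Order.TTheory GRing.Theory Num.Theory.

Record sgraph := SGraph {
  vertex :> finType;
  adj : rel vertex;
  adj_sym : symmetric adj;
  adj_irrefl : irreflexive adj }.

Definition iso (G H : sgraph) : Prop :=
  exists2 f : G -> H, bijective f & forall x y, adj (f x) (f y) = adj x y.

Definition edges (G : sgraph) : {set {set G}} :=
  [set [set p.1; p.2] | p : G * G & adj p.1 p.2].

Definition deg (G : sgraph) (x : G) : nat := #|[set y | adj x y]|.

(* Degrees are smaller than #|G|, so the neutral element #|G| does not affect
   the minimum as soon as G has a vertex. *)
Definition min_deg (G : sgraph) : nat := \big[minn/#|G|]_(x : G) deg x.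

Definition connected (G : sgraph) : Prop :=
  0 < #|G| /\ forall x y : G, connect (@adj G) x y.

Section Deletion.
Variables (G : sgraph) (F : {set {set G}}).

Definition del_adj : rel G := fun x y => adj x y && ([set x; y] \notin F).

Lemma del_adj_sym : symmetric del_adj.
Proof. by move=> x y; rewrite /del_adj adj_sym setUC. Qed.

Lemma del_adj_irrefl : irreflexive del_adj.
Proof. by move=> x; rewrite /del_adj adj_irrefl. Qed.

Definition del_edges : sgraph := SGraph del_adj_sym del_adj_irrefl.
End Deletion.

(* A path with initial vertex u is given by the sequence p of its subsequent
   vertices. *)
Definition is_upath (G : sgraph) (u v : G) (p : seq G) : bool :=
  [&& path (@adj G) u p, last u p == v & uniq (u :: p)].

Definition path_edges (G : sgraph) (u : G) (p : seq G) : seq {set G} :=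
  pairmap (fun x y => [set x; y]) u p.

Definition edge_disjoint_paths (G : sgraph) (u v : G) (k : nat) : Prop :=
  exists P : 'I_k -> seq G,
    (forall i, is_upath u v (P i)) /\
    (forall i j, i != j -> [disjoint path_edges u (P i) & path_edges u (P j)]).

Definition SM_lambda (G : sgraph) : Prop :=
  connected G /\
  forall u v : G, u != v -> edge_disjoint_paths u v (minn (deg u) (deg v)).

Definition SM_tolerant (r : nat) (G : sgraph) (m : int) : Prop :=
  forall F : {set {set G}},
    F \subset edges G -> (#|F|%:Z <= m)%R -> r <= min_deg (del_edges F) ->
    SM_lambda (del_edges F).

(* sm_lambda^r(G) = m.  This is a relation, since the maximum need not exist
   for arbitrary G and r. *)
Definition is_sm_lambda (r : nat) (G : sgraph) (m : int) : Prop :=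
  SM_tolerant r G m /\
  forall m' : int, SM_tolerant r G m' -> (m' <= m)%R.

Section K1.
Definition K1_adj : rel unit := fun _ _ => false.

Lemma K1_adj_sym : symmetric K1_adj. Proof. by []. Qed.

Lemma K1_adj_irrefl : irreflexive K1_adj. Proof. by []. Qed.

Definition K1 : sgraph := SGraph K1_adj_sym K1_adj_irrefl.
End K1.

Section MatchingSum.
Variables (G H : sgraph) (phi : G -> H).

Definition msum_adj : rel (G + H)%type := fun a b =>
  match a, b with
  | inl x, inl x' => adj x x'
  | inr y, inr y' => adj y y'
  | inl x, inr y | inr y, inl x => y == phi x
  end.

Lemma msum_adj_sym : symmetric msum_adj.
Proof. by move=> [x|x] [y|y] //=; rewrite adj_sym. Qed.

Lemma msum_adj_irrefl : irreflexive msum_adj.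
Proof. by move=> [x|x] /=; rewrite adj_irrefl. Qed.

Definition msum : sgraph := SGraph msum_adj_sym msum_adj_irrefl.
End MatchingSum.

(* Membership in HL_n is taken up to isomorphism. *)
Fixpoint HL (n : nat) (G : sgraph) : Prop :=
  if n is n'.+1 then
    exists G1 G2 : sgraph, exists phi : G1 -> G2,
      [/\ HL n' G1, HL n' G2, bijective phi & iso G (msum phi)]
  else iso G K1.

(* Main.v *)
(** Deleting F from G leaves a graph in which, by Menger's theorem for edges,
it suffices that every cut separating u from v has at least min(deg u, deg v)
edges.  A set of k vertices of G spans at most as many edges as the first k
vertices of the hypercube (the classical edge-isoperimetric bound, which only
uses the recursive matching structure).  If both sides of the cut have at least
2^r vertices, G has at least 2^r (n - r) edges across it, of which at least n
survive.  Otherwise one side, say that of u, has fewer than 2^r vertices and is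
so sparse that the minimum degree r already forces deg u edges to leave it.

For sharpness, take an r-dimensional sub-HL-network A of G, an edge uv leaving
it, and delete all but n - 1 boundary edges of A, keeping all those at u.  Then u
and v still have degree n while A is separated from the rest by n - 1 edges. *)
Require Import Defs.
From mathcomp Require Import all_boot all_order all_algebra.
From mathcomp Require Import zify.

Set Implicit Arguments.
Unset Strict Implicit.
Unset Printing Implicit Defensive.

Import Order.TTheory GRing.Theory Num.Theory.

(** * Menger's theorem for edges *)

(** Ordered pairs are counted, so [ecount A A] is twice the number of edges inside [A], in line with
    the doubled count of [cube_ex]. *)
Definition ecount (G : sgraph) (A B : {set G}) : nat :=
  \sum_(x in A) \sum_(y in B) adj x y.

Section Arcs.
Variable T : finType.
Implicit Types (u v x y : T) (p : seq T).

Definition arcs u p : seq (T * T) := pairmap pair u p.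

Lemma path_arcs (e : rel T) u p :
  path e u p = all (fun a => e a.1 a.2) (arcs u p).
Proof. by elim: p u => //= w p IH u; rewrite IH. Qed.

Lemma mem_arcs u p x y : (x, y) \in arcs u p -> (x \in u :: p) && (y \in u :: p).
Proof.
elim: p u => //= w p IH u; rewrite !inE xpair_eqE => /orP[/andP[-> ->]|].
  by rewrite orbT.
by move/IH; rewrite !inE => /andP[-> ->]; rewrite !orbT.
Qed.

(** Otherwise the set of vertices reachable from [u] would be a cut that no arc leaves. *)
Lemma upath_of_cuts (e : rel T) u v :
  (forall X : {set T}, u \in X -> v \notin X ->
     exists x y, [/\ x \in X, y \notin X & e x y]) ->
  exists p, [/\ path e u p, last u p = v & uniq (u :: p)].
Proof.
move=> cutP; have [/connectP[p pp ->]|nuv] := boolP (connect e u v).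
  by case: (shortenP pp) => q pq uq _; exists q.
have [||x [y []]] := cutP [set x | connect e u x]; rewrite ?inE //.
by move=> ux /negP uy exy; case: uy; apply: connect_trans ux (connect1 exy).
Qed.
End Arcs.

(** * Integral flows with unit capacities *)

Section Flow.
Local Open Scope ring_scope.
Variable G : sgraph.
Implicit Types (u v x y : G) (p : seq G) (X : {set G}) (f g : G -> G -> int).

Definition net f x : int := \sum_y f x y.

Lemma netD f g x : net (fun x y => f x y + g x y) x = net f x + net g x.
Proof. exact: big_split. Qed.

Lemma netB f g x : net (fun x y => f x y - g x y) x = net f x - net g x.
Proof. exact: sumrB. Qed.

(** By antisymmetry the contributions of pairs inside [X] cancel. *)
Lemma net_cut f X : (forall x y, f x y = - f y x) ->
  \sum_(x in X) net f x = \sum_(x in X) \sum_(y in ~: X) f x y.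
Proof.
move=> fN.
have netE x : net f x = \sum_(y in X) f x y + \sum_(y in ~: X) f x y.
  rewrite /net (bigID (mem X)) /=; congr (_ + _).
  by apply: eq_bigl => y; rewrite inE.
rewrite (eq_bigr _ (fun x _ => netE x)).
rewrite big_split /=; set S := (X in X + _).
suff -> : S = 0 by rewrite add0r.
have : S = - S; last by lia.
rewrite {1}/S exchange_big -sumrN; apply: eq_bigr => x _.
by rewrite -sumrN; apply: eq_bigr => y _.
Qed.

Definition arc_flow a b x y : int :=
  ((x == a) && (y == b) : nat)%:Z - ((x == b) && (y == a) : nat)%:Z.

Fixpoint path_flow u p x y : int :=
  if p is w :: p' then arc_flow u w x y + path_flow w p' x y else 0.

Lemma path_flowN u p x y : path_flow u p x y = - path_flow u p y x.
Proof.
elim: p u => [|w p IH] u /=; first by rewrite oppr0.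
by rewrite IH /arc_flow opprD opprB ![(y == _) && _]andbC.
Qed.

Lemma net_arc_flow a b x :
  net (arc_flow a b) x = (x == a : nat)%:Z - (x == b : nat)%:Z.
Proof.
rewrite /net sumrB.
have E c d : \sum_y ((x == c) && (y == d) : nat)%:Z = (x == c : nat)%:Z.
  rewrite (bigD1 d) //= eqxx andbT big1 ?addr0 // => y /negPf ->.
  by rewrite andbF.
by rewrite !E.
Qed.

Lemma net_path_flow u p x :
  net (path_flow u p) x = (x == u : nat)%:Z - (x == last u p : nat)%:Z.
Proof.
elim: p u => [|w p IH] u /=; first by rewrite /net big1 ?subrr.
by rewrite netD IH net_arc_flow; lia.
Qed.

Lemma path_flowE u p x y : uniq (u :: p) ->
  path_flow u p x y =
  ((x, y) \in arcs u p : nat)%:Z - ((y, x) \in arcs u p : nat)%:Z.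
Proof.
elim: p u => [|w p IH] u //=; rewrite inE negb_or -andbA => /and3P[uw up wp].
rewrite IH //= !inE !xpair_eqE /arc_flow.
have nu z t : (z, t) \in arcs w p -> (z != u) && (t != u).
  by move/mem_arcs; rewrite !inE; case: (eqVneq z u) => [->|_];
    case: (eqVneq t u) => [->|_]; rewrite ?(negPf uw) ?(negPf up) ?andbF.
rewrite [(y == _) && _]andbC; have := nu x y; have := nu y x.
case: ((y, x) \in _) => [/(_ isT)/andP[/negPf-> /negPf->] _|_].
  by rewrite ?andbF /=; lia.
case: (_ \in arcs w p) => [/(_ isT)/andP[/negPf-> /negPf->]|_].
  by rewrite ?andbF /=; lia.
by case: (x == u); case: (y == w); case: (x == w); case: (y == u).
Qed.

(** With antisymmetry, the upper bound also bounds [f] below: an edge carries at most one unit, in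
    one direction only, and a non-edge carries none. *)
Definition flow u v (k : nat) f : Prop :=
  [/\ forall x y, f x y = - f y x,
      forall x y, f x y <= (adj x y : nat)%:Z &
      forall x, net f x = k%:Z * ((x == u : nat)%:Z - (x == v : nat)%:Z)].

Lemma flow_cut u v k f X : flow u v k f -> u \in X -> v \notin X ->
  \sum_(x in X) \sum_(y in ~: X) f x y = k%:Z.
Proof.
case=> fN _ fnet uX vX; rewrite -net_cut //.
rewrite (bigD1 u) //= big1 ?addr0 => [|x /andP[xX /negPf xu]]; rewrite fnet.
  by rewrite eqxx; case: eqP vX uX => [->|_] /= ; [move/negPf-> | lia].
by rewrite xu; case: eqP xX vX => [-> ->//|_]; lia.
Qed.

Lemma cut_lt_sum f g X :
  \sum_(x in X) \sum_(y in ~: X) f x y < \sum_(x in X) \sum_(y in ~: X) g x y ->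
  exists x y, [/\ x \in X, y \notin X & f x y < g x y].
Proof.
move=> lt; have [/existsP[x /existsP[y /and3P[]]]|/existsPn no] :=
  boolP [exists x, exists y, [&& x \in X, y \notin X & f x y < g x y]].
  by exists x, y.
move: lt; rewrite ltNge => /negP[]; apply: ler_sum => x xX; apply: ler_sum => y.
rewrite inE => yX; have /existsPn/(_ y) := no x.
by rewrite xX yX /= -leNgt.
Qed.

(** Ford-Fulkerson augmentation: a flow of value [j < k] leaves spare capacity across every cut,
    hence a path along which one more unit fits. *)
Lemma flow_exists u v k :
  (forall X, u \in X -> v \notin X -> k <= ecount X (~: X))%N ->
  exists f, flow u v k f.
Proof.
move=> cutk; have : (k <= k)%N by []; move: {1 3}k => j.
elim: j => [|j IH] jk.
  by exists (fun _ _ => 0); split=> // *; rewrite ?mul0r ?oppr0 // /net big1.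
have [f ff] := IH (ltnW jk); have [fN fle fnet] := ff.
have [X uX vX|p [pp pl pu]] :=
  @upath_of_cuts _ (fun x y => f x y < (adj x y : nat)%:Z) u v.
  apply: cut_lt_sum; rewrite (flow_cut ff) //.
  apply: (@lt_le_trans _ _ k%:Z); first by lia.
  have := cutk X uX vX; rewrite /ecount -lez_nat => /le_trans; apply.
  rewrite (big_morph Posz PoszD (erefl _)); apply: ler_sum => x _.
  by rewrite (big_morph Posz PoszD (erefl _)).
exists (fun x y => f x y + path_flow u p x y); split=> [x y|x y|x].
- by rewrite fN path_flowN; lia.
- rewrite path_flowE //; have := fle x y; move: pp; rewrite path_arcs => /allP.
  by case: (boolP ((x, y) \in _)) => [+ H|_ _]; [move/H => /=|]; lia.
- by rewrite netD fnet net_path_flow pl; lia.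
Qed.

(** Some arc of positive flow leaves every cut between [u] and [v], so such arcs contain a simple
    path; subtracting its flow lowers the value by one. *)
Lemma flow_decomposition u v k f : flow u v k f ->
  exists P : 'I_k -> seq G,
    [/\ forall i, [/\ path (fun x y => 0 < f x y) u (P i), last u (P i) = v &
                      uniq (u :: P i)] &
        forall i j, i != j -> [disjoint path_edges u (P i) & path_edges u (P j)]].
Proof.
elim: k f => [|k IH] f ff; first by exists (fun=> [::]); split; case.
have [fN fle fnet] := ff.
have [X uX vX|p [pp pl pu]] := @upath_of_cuts _ (fun x y => 0 < f x y) u v.
  apply: (@cut_lt_sum (fun _ _ => 0)); rewrite (flow_cut ff) //.
  by rewrite big1 // => x _; rewrite big1.
have pos x y : (x, y) \in arcs u p -> 0 < f x y.
  by move: pp; rewrite path_arcs => /allP/(_ (x, y)).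
pose g x y := f x y - path_flow u p x y.
have gE x y : g x y = f x y - ((x, y) \in arcs u p : nat)%:Z
                            + ((y, x) \in arcs u p : nat)%:Z.
  by rewrite /g path_flowE //; lia.
have le1 x y : f x y <= 1 by apply: le_trans (fle x y) _; case: adj.
have [|P [Pu Pd]] := IH g.
  split=> [x y|x y|x].
  - by rewrite /g fN path_flowN; lia.
  - rewrite gE; have := fle x y; have := fN x y; have := @pos y x.
    by case: ((y, x) \in _) => [/(_ isT)|_]; case: (_ \in arcs u p); lia.
  - by rewrite netB fnet net_path_flow pl; lia.
have gpos x y : 0 < g x y -> 0 < f x y.
  rewrite gE; have := fN x y; have := @pos y x.
  by case: ((y, x) \in _) => [/(_ isT)|_]; case: (_ \in arcs u p); lia.
(* Integrality and unit capacity force [f] to be 1 on the arcs of [p], so [g] vanishes on these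
   edges and later paths cannot reuse them. *)
have garc x y : (x, y) \in arcs u p -> g x y = 0.
  move=> xy; rewrite gE xy; have := pos _ _ xy; have := le1 x y.
  have := fN x y; have := @pos y x.
  by case: (_ \in arcs u p) => [/(_ isT)|_]; lia.
have dis i : [disjoint path_edges u p & path_edges u (P i)].
  have [Pp _ _] := Pu i; move: Pp; rewrite path_arcs => /allP Pp.
  have edgesE q : path_edges u q = [seq [set a.1; a.2] | a <- arcs u q].
    by rewrite /path_edges /arcs; elim: q (u) => //= w q IHq z; rewrite IHq.
  apply/pred0Pn => -[e /=]; rewrite !edgesE => /andP[/mapP[[x y] xy ->]].
  case/mapP => -[z t] /[dup] /Pp /= gzt _ /setP E.
  have gN a b : g a b = - g b a by rewrite /g fN path_flowN; lia.
  have gxy := garc _ _ xy; have gyx := gN y x.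
  have gxx := gN x x; have gyy := gN y y.
  move: (E z) (E t); rewrite !inE !eqxx orbT /=.
  by move=> /orP[] /eqP ez /orP[] /eqP et; move: gzt; rewrite ez et; lia.
exists (fun i => if unlift ord0 i is Some j then P j else p); split=> [i|i j].
  case: unliftP => [j _|_] //; have [pj lj uj] := Pu j; split=> //.
  by apply: sub_path pj => x y; apply: gpos.
case: unliftP => [i'|] ->; case: unliftP => [j'|] -> //.
- by rewrite (inj_eq lift_inj) => /Pd.
- by rewrite disjoint_sym => _; apply: dis.
Qed.

Lemma edge_menger u v k :
  (forall X, u \in X -> v \notin X -> k <= ecount X (~: X))%N ->
  edge_disjoint_paths u v k.
Proof.
case/flow_exists => f ff; have [P [Pu Pd]] := flow_decomposition ff.
exists P; split=> // i; have [pi li ui] := Pu i; rewrite /is_upath li eqxx ui.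
rewrite !andbT; apply: sub_path pi => x y; have [_ /(_ x y) + _] := ff.
by case: adj => //=; lia.
Qed.
End Flow.

(** * The extremal function of the hypercube *)

(* [cube_ex k] is twice the number of edges spanned by the vertices 0, ..., k - 1 of
   the hypercube; separating even from odd vertices gives the recursion.  The
   first argument of [cube_ex_fuel] only bounds the depth of the recursion. *)
Fixpoint cube_ex_fuel (f k : nat) : nat :=
  if f is f'.+1 then
    if k <= 1 then 0
    else cube_ex_fuel f' k./2 + cube_ex_fuel f' (uphalf k) + k./2.*2
  else 0.

Definition cube_ex (k : nat) : nat := cube_ex_fuel k k.

Lemma cube_ex_fuel_eq f g k : k <= f.+1 -> k <= g.+1 ->
  cube_ex_fuel f k = cube_ex_fuel g k.
Proof.
elim: f g k => [|f IH] [|g] k //= kf kg; case: leqP => // k1; try lia.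
by rewrite (IH g k./2) ?(IH g (uphalf k)) //; lia.
Qed.

Lemma cube_exE k : cube_ex k = cube_ex k./2 + cube_ex (uphalf k) + k./2.*2.
Proof.
case: (leqP k 1) => [|k1]; first by case: k => [|[]].
rewrite {1}/cube_ex -[X in cube_ex_fuel X _](@ltn_predK 1 k) //= leqNgt k1 /=.
by congr (_ + _ + _); apply: cube_ex_fuel_eq; lia.
Qed.

Lemma cube_ex_double m : cube_ex m.*2 = (cube_ex m + m).*2.
Proof. by rewrite cube_exE doubleK uphalf_double; lia. Qed.

Lemma cube_ex_doubleS m : cube_ex m.*2.+1 = cube_ex m + cube_ex m.+1 + m.*2.
Proof.
rewrite cube_exE; have -> : m.*2.+1./2 = m by lia.
by have -> : uphalf m.*2.+1 = m.+1 by lia.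
Qed.

(* [minn a b] bounds the number of matching edges between parts of sizes [a] and
   [b] of the two halves of a network. *)
Lemma cube_ex_superadditive a b :
  cube_ex a + cube_ex b + (minn a b).*2 <= cube_ex (a + b).
Proof.
have [N] := ubnP (a + b); elim: N a b => // N IH a b abN.
have [->|a0] := posnP a; first by rewrite add0n min0n addn0.
have [->|b0] := posnP b; first by rewrite addn0 minn0 !addn0.
rewrite -(odd_double_half a) -(odd_double_half b) in a0 b0 abN *.
move: (a./2) (b./2) a0 b0 abN => c d.
case: (odd a); case: (odd b); rewrite ?add0n ?add1n => a0 b0 abN.
(* The smaller half of each number is paired with the larger half of the other, so that both sums
   are [(c + d).+1]. *)
- have -> : c.*2.+1 + d.*2.+1 = (c + d).+1.*2 by lia.
  rewrite !cube_ex_doubleS cube_ex_double.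
  have := IH c d.+1; have := IH c.+1 d; rewrite addSn addnS; lia.
- have -> : c.*2.+1 + d.*2 = (c + d).*2.+1 by lia.
  rewrite !cube_ex_doubleS cube_ex_double.
  have := IH c d; have := IH c.+1 d; rewrite addSn; lia.
- have -> : c.*2 + d.*2.+1 = (c + d).*2.+1 by lia.
  rewrite !cube_ex_doubleS cube_ex_double.
  have := IH c d; have := IH c d.+1; rewrite addnS; lia.
- have -> : c.*2 + d.*2 = (c + d).*2 by lia.
  rewrite !cube_ex_double.
  have := IH c d; lia.
Qed.

Lemma cube_ex_exp2 s : cube_ex (2 ^ s) = s * 2 ^ s.
Proof. by elim: s => [|s IH] //; rewrite expnS mul2n cube_ex_double IH; lia. Qed.

(* [cube_ex] lies below its chord between 2^t and 2^(t+1). *)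
Lemma cube_ex_chord t k :
  2 ^ t <= k <= 2 ^ t.+1 -> cube_ex k + 2 ^ t.+1 <= t.+2 * k.
Proof.
elim: t k => [|t IH] k; first by case: k => [|[|[|]]].
rewrite -(odd_double_half k); move: (k./2) => m.
rewrite ![2 ^ _.+1]expnS in IH *.
case: (odd k); rewrite ?add0n ?add1n ?cube_ex_double ?cube_ex_doubleS => kt.
  by have := IH m; have := IH m.+1; nia.
by have := IH m; nia.
Qed.

(** Equality holds at [k = 2 ^ r - 1], the cube without one vertex. If all degrees are at least [r],
    then [k.-1] vertices pay for all edges inside a set of size [k], and the degree of the last one
    is left over. *)
Lemma cube_ex_lt_exp2 r k : 0 < k < 2 ^ r -> cube_ex k <= r * k.-1.
Proof.
elim: r k => [|r IH] k; first by case: k.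
rewrite -(odd_double_half k); move: (k./2) => m.
rewrite expnS.
case: (odd k); rewrite ?add0n ?add1n ?cube_ex_double ?cube_ex_doubleS => kt.
  have [->|m0] := posnP m; first by rewrite muln0.
  (* The larger half may equal [2 ^ r], beyond the induction hypothesis; the exact value is used
     there. *)
  have := IH m; have [e|ne] := eqVneq m.+1 (2 ^ r).
    by rewrite e cube_ex_exp2 -e; nia.
  by have := IH m.+1; nia.
have r0 : 0 < r by move: kt; case: (r) => //=; lia.
by have := IH m; nia.
Qed.

Lemma cut_size_ge n r k : r.+2 <= n -> 2 ^ r <= k <= 2 ^ n.-1 ->
  2 ^ r * (n - r) + cube_ex k <= n * k.
Proof.
(* For k in [2^t, 2^(t+1)] the chord bound reduces the claim to k = 2^t, and
   2^t (n - t) increases with t. *)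
move=> rn kr; have k0 : 0 < k by have := expn_gt0 2 r; lia.
have mono t : r <= t -> t.+1 < n -> 2 ^ r * (n - r) <= 2 ^ t * (n - t).
  elim: t => [|t IH] rt tn; first by have -> : r = 0 by lia.
  have [->//|ne] := eqVneq r t.+1.
  have {}IH := IH ltac:(lia) ltac:(lia).
  by apply: leq_trans IH _; rewrite expnS; nia.
have [t [rt tn tk]] : exists t, [/\ r <= t, t.+1 < n & 2 ^ t <= k <= 2 ^ t.+1].
  (* [k = 2 ^ n.-1] is taken as the right end of its dyadic interval, since [t = n.-1] would violate
     [t.+1 < n]. *)
  have [e|ne] := eqVneq k (2 ^ n.-1).
    exists n.-2; split; try lia.
    have -> : n.-2.+1 = n.-1 by lia.
    by rewrite e leqnn andbT leq_exp2l //; lia.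
  exists (trunc_log 2 k); have [] := trunc_log_bounds (isT : 1 < 2) k0 => /andP[l u].
  split; last by lia.
    rewrite -ltnS -(@ltn_exp2l 2) //; lia.
  have : 2 ^ trunc_log 2 k < 2 ^ n.-1 by lia.
  by rewrite ltn_exp2l //; lia.
have := cube_ex_chord tk; have := mono t rt tn; rewrite expnS.
move: (2 ^ t) (2 ^ r * (n - r)) tk => T S; rewrite expnS => /andP [tk _] h1 h2.
have : T * (n - t) + t.+2 * k <= n * k + 2 * T; last by lia.
(* With [n = t.+2 + d] the inequality reduces to [d * T <= d * k]. *)
have [d ->] : exists d, n = t.+2 + d by exists (n - t.+2); lia.
have -> : t.+2 + d - t = d.+2 by lia.
by nia.
Qed.

(** * Hypercube-like networks *)

Definition ndeg (G : sgraph) (A : {set G}) (x : G) : nat := \sum_(y in A) adj x y.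

Lemma ndegE (G : sgraph) (A : {set G}) x : ndeg A x = #|[set y in A | adj x y]|.
Proof.
rewrite -sum1dep_card /ndeg big_mkcondr; apply: eq_bigr => y _.
by case: adj.
Qed.

Lemma degE (G : sgraph) (x : G) : deg x = ndeg setT x.
Proof. by rewrite ndegE; apply: eq_card => y; rewrite !inE. Qed.

Lemma degC (G : sgraph) (A : {set G}) x : deg x = ndeg A x + ndeg (~: A) x.
Proof.
rewrite degE /ndeg (bigID (mem A)) /=.
by congr (_ + _); apply: eq_bigl => y; rewrite !inE.
Qed.

Lemma ecountE (G : sgraph) (A B : {set G}) :
  ecount A B = \sum_(x in A) ndeg B x.
Proof. by []. Qed.

Lemma ecountC (G : sgraph) (A B : {set G}) : ecount A B = ecount B A.
Proof.
rewrite /ecount exchange_big; apply: eq_bigr => x _.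
by apply: eq_bigr => y _; rewrite adj_sym.
Qed.

Lemma sum_deg (G : sgraph) (A : {set G}) :
  \sum_(x in A) deg x = ecount A A + ecount A (~: A).
Proof. by rewrite !ecountE -big_split; apply: eq_bigr => x _; apply: degC. Qed.

Lemma HL_ind (P : nat -> sgraph -> Prop) :
  (forall n G H, iso G H -> P n H -> P n G) -> P 0 K1 ->
  (forall n (G H : sgraph) (phi : G -> H), bijective phi -> P n G -> P n H ->
     P n.+1 (msum phi)) ->
  forall n G, HL n G -> P n G.
Proof.
move=> Piso P0 PS; elim=> [|n IH] G /=; first by move/Piso; apply.
case=> G1 [G2 [phi [h1 h2 bphi /Piso]]]; apply.
by apply: PS => //; apply: IH.
Qed.

Lemma ndeg_iso (G H : sgraph) (f : G -> H) (A : {set H}) x :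
  bijective f -> (forall x y, adj (f x) (f y) = adj x y) ->
  ndeg (f @^-1: A) x = ndeg A (f x).
Proof.
move=> bf fadj; rewrite /ndeg [RHS](reindex f) /=; last exact: onW_bij.
by apply: eq_big => [y|y _]; rewrite ?inE ?fadj.
Qed.

Lemma card_preim_bij (G H : finType) (f : G -> H) (A : {set H}) :
  bijective f -> #|f @^-1: A| = #|A|.
Proof.
move=> bf; rewrite -!sum1_card [RHS](reindex f) /=; last exact: onW_bij.
by apply: eq_bigl => y; rewrite inE.
Qed.

Lemma HL_card n G : HL n G -> #|G| = 2 ^ n.
Proof.
move: n G; apply: HL_ind => [n G H [f bf _] <-||n G H phi bphi GE HE].
- exact: bij_eq_card bf.
- by rewrite card_unit.
- by rewrite card_sum GE HE expnS mul2n addnn.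
Qed.

Lemma sum_msum (G H : sgraph) (phi : G -> H) (A : {set msum phi}) F :
  \sum_(z in A) F z = \sum_(x in inl @^-1: A) F (inl x) +
                      \sum_(y in inr @^-1: A) F (inr y) :> nat.
Proof.
rewrite big_sumType /=.
by congr (_ + _); apply: eq_bigl => x; rewrite inE.
Qed.

Section Matching.
Variables (G H : sgraph) (phi : G -> H) (A : {set msum phi}).

Lemma ndeg_inl (x : G) :
  ndeg A (inl x : msum phi) = ndeg (inl @^-1: A) x + (inr (phi x) \in A).
Proof.
rewrite /ndeg sum_msum /=; congr (_ + _).
have [xA|xA] := boolP (_ \in A).
  rewrite (bigD1 (phi x)) ?inE //= eqxx big1 // => y /andP[_ /negPf->] //.
rewrite big1 // => y; rewrite inE; case: eqP => // ->.
by rewrite (negPf xA).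
Qed.

Lemma ndeg_inr (y : H) (psi : H -> G) : cancel phi psi -> cancel psi phi ->
  ndeg A (inr y : msum phi) = ndeg (inr @^-1: A) y + (inl (psi y) \in A).
Proof.
move=> phiK psiK; rewrite /ndeg sum_msum /= addnC; congr (_ + _).
have E x : (y == phi x) = (x == psi y).
  by apply/eqP/eqP => [->|->]; rewrite ?phiK ?psiK.
under eq_bigr do rewrite E.
have [xA|xA] := boolP (_ \in A).
  rewrite (bigD1 (psi y)) ?inE //= eqxx big1 // => x /andP[_ /negPf->] //.
rewrite big1 // => x; rewrite inE; case: eqP => // ->.
by rewrite (negPf xA).
Qed.
End Matching.

Lemma HL_deg n G : HL n G -> forall x : G, deg x = n.
Proof.
move: n G; apply: HL_ind => [n G H [f bf fadj] HE x
  ||n G H phi [psi phiK psiK] GE HE [x|y]].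
- by rewrite -(HE (f x)) !degE -(ndeg_iso _ _ bf fadj) preimsetT.
- by move=> x; rewrite degE /ndeg big1.
- by rewrite degE ndeg_inl inE preimsetT -degE GE addn1.
- by rewrite degE (ndeg_inr _ _ phiK psiK) inE preimsetT -degE HE addn1.
Qed.

(** Edges inside either half are bounded by induction, and those between the halves by the size of
    the smaller part, since they form a matching; [cube_ex_superadditive] absorbs both. *)
Lemma HL_edge_isoperimetry n G : HL n G ->
  forall A : {set G}, ecount A A <= cube_ex #|A|.
Proof.
move: n G; apply: HL_ind => [n G H [f bf fadj] HE A
  ||n G H phi [psi phiK psiK] GE HE A].
- have [g fK gK] := bf.
  have -> : A = f @^-1: (g @^-1: A) by apply/setP=> x; rewrite !inE fK.
  rewrite card_preim_bij // ecountE; under eq_bigr do rewrite (ndeg_iso _ _ bf fadj).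
  move: (g @^-1: A) => B; apply: leq_trans (HE B).
  rewrite ecountE [leqRHS](reindex f) /=; last exact: onW_bij.
  by apply: eq_leq; apply: eq_bigl => x; rewrite inE.
- by move=> A; rewrite ecountE big1 // => x _; rewrite /ndeg big1.
set B := inl @^-1: A; set C := inr @^-1: A.
have cardA : #|A| = #|B| + #|C| by rewrite -!sum1_card sum_msum.
have -> : ecount A A =
    ecount B B + ecount C C +
    (\sum_(x in B) (phi x \in C) + \sum_(y in C) (psi y \in B)).
  rewrite ecountE sum_msum.
  under eq_bigr do rewrite ndeg_inl.
  under [X in _ + X]eq_bigr do rewrite (ndeg_inr _ _ phiK psiK).
  rewrite !big_split /= -!ecountE addnACA.
  by congr (_ + (_ + _)); apply: eq_bigr => x _; rewrite inE.
have le1 : \sum_(x in B) (phi x \in C) <= #|B|.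
  by rewrite -sum1_card; apply: leq_sum => x _; apply: leq_b1.
have le2 : \sum_(y in C) (psi y \in B) <= #|C|.
  by rewrite -sum1_card; apply: leq_sum => x _; apply: leq_b1.
have e12 : \sum_(x in B) (phi x \in C) = \sum_(y in C) (psi y \in B).
  rewrite [LHS]big_mkcond [RHS]big_mkcond [RHS](reindex phi) /=.
    by apply: eq_bigr => x _; rewrite phiK; case: (x \in B); case: (phi x \in C).
  by exists psi => x _.
have := cube_ex_superadditive #|B| #|C|; have := GE B; have := HE C; rewrite cardA.
lia.
Qed.

(** Descend into one half until the dimension is [r]. Outside vertices of that half are covered by
    induction; a vertex of the other half meets the set only through its matching edge. *)
Lemma HL_subcube n G r : HL n G -> r <= n ->
  exists A : {set G}, [/\ #|A| = 2 ^ r, forall x, x \in A -> ndeg A x = r &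
                          forall x, x \notin A -> ndeg A x <= 1].
Proof.
elim: n G => [|n IH] G hG rn; last have [e|ne] := eqVneq r n.+1.
- exists setT; move: rn; rewrite leqn0 => /eqP ->.
  rewrite cardsT (HL_card hG); split=> // x; last by rewrite inE.
  by rewrite -degE (HL_deg hG).
- exists setT; rewrite cardsT (HL_card hG) e; split=> // x; last by rewrite inE.
  by rewrite -degE (HL_deg hG).
case: hG => G1 [G2 [phi [h1 h2 bphi [f bf fadj]]]].
have [|B [cB dB oB]] := IH G1 h1; first by lia.
pose A : {set msum phi} := inl @: B.
have AE x : (inl x \in A) = (x \in B) by rewrite mem_imset // => ? ? [].
have AE' y : (inr y \in A) = false by apply/negP => /imsetP[].
have E1 : inl @^-1: A = B by apply/setP=> x; rewrite inE AE.
have E2 : inr @^-1: A = set0 by apply/setP=> x; rewrite !inE AE'.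
have [psi phiK psiK] := bphi.
exists (f @^-1: A); rewrite card_preim_bij //; split=> [|x|x].
- by rewrite card_imset // => ? ? [].
- rewrite inE (ndeg_iso _ _ bf fadj); case: (f x) => y; last by rewrite AE'.
  by rewrite AE => /dB; rewrite ndeg_inl E1 AE' addn0.
- rewrite inE (ndeg_iso _ _ bf fadj); case: (f x) => y.
    by rewrite AE => /oB; rewrite ndeg_inl E1 AE' addn0.
  by rewrite (ndeg_inr _ _ phiK psiK) E2 /ndeg big_set0 add0n leq_b1.
Qed.

(** * Cuts after deleting edges *)

(** The condition [r <= #|G|] reflects the neutral element of the minimum. *)
Lemma leq_min_deg (G : sgraph) r :
  r <= min_deg G <-> r <= #|G| /\ forall x : G, r <= deg x.
Proof.
rewrite /min_deg; split=> [rm|[rG rd]]; last first.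
  by apply: (big_ind (fun m => r <= m)) => // a b; rewrite leq_min => -> ->.
split=> [|x]; apply: leq_trans rm _.
  by elim: (index_enum _) => [|y s IH]; rewrite ?big_nil // big_cons geq_min IH orbT.
have := mem_index_enum x; elim: (index_enum _) => //= y s IH.
by rewrite inE big_cons geq_min => /orP[/eqP->|/IH ->]; rewrite ?leqnn ?orbT.
Qed.

Lemma subset_of_card (T : finType) (A : {set T}) k : k <= #|A| ->
  exists2 B : {set T}, B \subset A & #|B| = k.
Proof.
move=> kA; exists [set x in take k (enum A)].
  by apply/subsetP => x; rewrite inE => /mem_take; rewrite mem_enum.
rewrite cardsE (card_uniqP _) ?take_uniq ?enum_uniq // size_takel //.
by rewrite -cardE.
Qed.

Definition boundary (G : sgraph) (A : {set G}) : {set {set G}} :=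
  [set [set p.1; p.2] | p : G * G & [&& p.1 \in A, p.2 \notin A & adj p.1 p.2]].

Lemma mem_boundary (G : sgraph) (A : {set G}) x y :
  ([set x; y] \in boundary A) = adj x y && ((x \in A) != (y \in A)).
Proof.
apply/imsetP/andP => [[[a b]]|[xy]].
  rewrite inE /= => /and3P[aA bA ab] /setP E.
  have neq : a != b by apply: contraNneq bA => <-.
  have := E x; have := E y; have := E a; have := E b.
  rewrite !inE !eqxx ?orbT /= => Eb Ea /esym Ey /esym Ex.
  case/orP: Ex => /eqP xe; case/orP: Ey => /eqP ye; rewrite xe ye.
  - by move: Eb; rewrite xe ye orbb eq_sym (negPf neq).
  - by rewrite aA (negPf bA).
  - by rewrite adj_sym aA (negPf bA).
  - by move: Ea; rewrite xe ye orbb (negPf neq).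
have [xA|xA] := boolP (x \in A); have [yA|yA] := boolP (y \in A) => // _.
  by exists (x, y); rewrite // inE xA yA.
by exists (y, x); rewrite ?inE /= ?xA ?yA ?(adj_sym y) // setUC.
Qed.

Lemma boundaryP (G : sgraph) (A : {set G}) e : e \in boundary A ->
  exists x y, [/\ e = [set x; y], x \in A, y \notin A & adj x y].
Proof.
by case/imsetP => [[x y]]; rewrite inE => /and3P[*]; exists x, y.
Qed.

Lemma card_boundary (G : sgraph) (A : {set G}) : #|boundary A| = ecount A (~: A).
Proof.
rewrite card_in_imset => [|[x y] [z t]].
  rewrite /ecount pair_big_dep /= -sum1dep_card.
  rewrite [RHS](eq_bigr (fun p => if adj p.1 p.2 then 1 else 0)).
    by rewrite -big_mkcondr; apply: eq_bigl => p; rewrite !inE andbA.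
  by move=> p _; case: adj.
rewrite !inE /= => /and3P[xA yA _] /and3P[zA tA _] /setP E.
have := E x; have := E y; rewrite !inE !eqxx orbT /= => /esym Ey /esym Ex.
have -> : x = z by case/orP: Ex => /eqP // xt; case/negP: tA; rewrite -xt.
by case/orP: Ey => /eqP yz; [case/negP: yA; rewrite yz | rewrite yz].
Qed.

Lemma boundary_edges (G : sgraph) (A : {set G}) : boundary A \subset edges G.
Proof.
apply/subsetP => e /boundaryP[x [y [-> _ _ xy]]].
by apply/imsetP; exists (x, y); rewrite ?inE.
Qed.

Lemma boundary_del (G : sgraph) (F : {set {set G}}) (A : {set G}) :
  boundary (A : {set del_edges F}) = boundary A :\: F.
Proof.
apply/setP => e; apply/idP/setDP => [|[eA nF]].
  move=> /boundaryP[x [y [-> xA yA /andP[xy nF]]]].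
  by split=> //; have := @mem_boundary G A x y; rewrite xy xA (negPf yA).
have [x [y [eE xA yA xy]]] := @boundaryP G A e eA; rewrite eE in nF *.
have := @mem_boundary (del_edges F) A x y.
by rewrite xA (negPf yA) andbT /= /del_adj xy nF.
Qed.

Lemma card_boundary_del (G : sgraph) (F : {set {set G}}) (A : {set G}) :
  #|boundary A :\: F| = ecount (A : {set del_edges F}) (~: A).
Proof. by rewrite -boundary_del; apply: (@card_boundary (del_edges F)). Qed.

Lemma path_crosses_boundary (G : sgraph) (A : {set G}) u p :
  path (@adj G) u p -> u \in A -> last u p \notin A ->
  exists2 e, e \in path_edges u p & e \in boundary A.
Proof.
elim: p u => [|w p IH] u /=; first by move=> _ ->.
case/andP => uw wp uA lA; have [wA|wA] := boolP (w \in A).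
  by have [e e1 e2] := IH w wp wA lA; exists e; rewrite // inE e1 orbT.
by exists [set u; w]; rewrite ?mem_head // mem_boundary uw uA (negPf wA).
Qed.

(** The easy half of Menger's theorem: every path crosses the cut, and edge-disjoint paths cross it
    at different edges. *)
Lemma edge_disjoint_le_boundary (G : sgraph) (A : {set G}) u v k :
  edge_disjoint_paths u v k -> u \in A -> v \notin A -> k <= #|boundary A|.
Proof.
case=> P [Pu Pd] uA vA.
have /fin_all_exists[e eP] (i : 'I_k) :
    exists e, (e \in path_edges u (P i)) && (e \in boundary A).
  have /and3P[pi /eqP li _] := Pu i; rewrite -li in vA.
  by have [e e1 e2] := path_crosses_boundary pi uA vA; exists e; apply/andP.
have einj : injective e.
  move=> i j eij; apply/eqP/negPn/negP => /Pd/pred0Pn[]; exists (e i) => /=.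
  by have /andP[-> _] := eP i; have /andP[+ _] := eP j; rewrite eij.
rewrite -[k]card_ord -(card_imset _ einj); apply/subset_leq_card/subsetP => f.
by case/imsetP => i _ ->; have /andP[] := eP i.
Qed.

Lemma ndeg_del (G : sgraph) (F : {set {set G}}) (A : {set G}) (x : G) :
  (forall y, y \in A -> [set x; y] \notin F) ->
  ndeg (A : {set del_edges F}) x = ndeg A x.
Proof. by move=> nF; apply: eq_bigr => y /nF H; rewrite /= /del_adj H andbT. Qed.

Lemma ecount_del_le (G : sgraph) (F : {set {set G}}) (A B : {set G}) :
  ecount (A : {set del_edges F}) B <= ecount A B.
Proof.
apply: leq_sum => x _; apply: leq_sum => y _; rewrite /= /del_adj.
by case: (@adj G x y); rewrite ?leq_b1.
Qed.

(** * Lower bounds on cuts of the damaged network *)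

Section Deleted.
Variables (n r : nat) (G : sgraph) (F : {set {set G}}).
Hypothesis hG : HL n G.
Let D := del_edges F.

(** The degrees over [A] sum to at least [deg u + r * #|A|.-1], of which at most [r * #|A|.-1] is
    spent inside [A], by isoperimetry and [cube_ex_lt_exp2]. *)
Lemma small_cut (A : {set G}) (u : D) : (forall x : D, r <= deg x) ->
  u \in A -> #|A| < 2 ^ r -> deg u <= ecount (A : {set D}) (~: A).
Proof.
move=> rdeg uA Ar; have A0 : 0 < #|A| by apply/card_gt0P; exists u.
have := sum_deg (A : {set D}); rewrite (bigD1 u) //=.
have : r * #|A|.-1 <= \sum_(x in A | x != u) deg (x : D).
  rewrite (cardsD1 u) uA /= mulnC -sum_nat_const.
  rewrite [leqRHS](eq_bigl (mem (A :\ u))); last by move=> x; rewrite !inE andbC.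
  by apply: leq_sum.
have := ecount_del_le F A A; have := HL_edge_isoperimetry hG A.
have /cube_ex_lt_exp2 : 0 < #|A| < 2 ^ r by rewrite A0.
rewrite -/D; lia.
Qed.

(** In [G] the degree sum [n * #|A|] leaves at least [2 ^ r * (n - r)] boundary edges, and deleting
    [F] spares at least [n] of them. *)
Lemma middle_cut (A : {set G}) :
  r.+2 <= n -> #|F| + n <= 2 ^ r * (n - r) -> 2 ^ r <= #|A| <= 2 ^ n.-1 ->
  n <= ecount (A : {set D}) (~: A).
Proof.
move=> rn Fle Ar; have := cut_size_ge rn Ar.
have : n * #|A| = ecount A A + ecount A (~: A).
  rewrite -sum_deg mulnC -sum_nat_const; apply: eq_bigr => x _.
  by rewrite (HL_deg hG).
have := HL_edge_isoperimetry hG A.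
have := subset_leq_card (subsetIr (boundary A) F); have := cardsID F (boundary A).
have := card_boundary A; have := card_boundary_del F A; rewrite -/D.
lia.
Qed.

Lemma cut_ge_min_deg (A : {set G}) (u v : D) :
  r.+2 <= n -> #|F| + n <= 2 ^ r * (n - r) -> (forall x : D, r <= deg x) ->
  u \in A -> v \notin A -> minn (deg u) (deg v) <= ecount (A : {set D}) (~: A).
Proof.
move=> rn Fle rdeg uA vA.
have ecC : ecount (A : {set D}) (~: A) = ecount (~: A : {set D}) (~: ~: A).
  by rewrite setCK ecountC.
have cardC : #|A| + #|~: A| = 2 ^ n by rewrite cardsC (HL_card hG).
have n2 : 2 ^ n = 2 * 2 ^ n.-1 by rewrite -expnS; congr (2 ^ _); lia.
have degn : deg u <= n.
  rewrite -(HL_deg hG u); apply/subset_leq_card/subsetP => y.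
  by rewrite !inE => /andP[].
have [A1|A1] := ltnP #|A| (2 ^ r).
  by apply: leq_trans (geq_minl _ _) (small_cut rdeg uA A1).
have [A2|A2] := ltnP #|~: A| (2 ^ r).
  rewrite ecC; apply: leq_trans (geq_minr _ _) (small_cut rdeg _ A2).
  by rewrite inE.
(* As [deg u] is at most [n], it suffices that [n] edges survive; the side with at most half of all
   vertices is examined. *)
apply: leq_trans (geq_minl _ _) (leq_trans degn _).
have [A3|A3] := leqP #|A| (2 ^ n.-1); first by apply: middle_cut; rewrite ?A1.
by rewrite ecC; apply: middle_cut; rewrite // A2; lia.
Qed.
End Deleted.

Lemma HL_del_SM n r (G : sgraph) (F : {set {set G}}) : HL n G ->
  0 < r -> r.+2 <= n -> #|F| + n <= 2 ^ r * (n - r) -> r <= min_deg (del_edges F) ->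
  SM_lambda (del_edges F).
Proof.
move=> hG r0 rn Fle /leq_min_deg[_ rdeg].
have paths (u v : del_edges F) : u != v ->
    edge_disjoint_paths u v (minn (deg u) (deg v)).
  by move=> uv; apply: edge_menger => A uA vA; exact: (cut_ge_min_deg hG rn).
split=> //; split; first by rewrite (HL_card hG) expn_gt0.
move=> u v; have [->//|/paths] := eqVneq u v.
(* Connectedness: [r > 0] makes the number of paths between distinct vertices positive. *)
have : 0 < minn (deg u) (deg v) by rewrite leq_min !(leq_trans r0).
case: minn => // k _ [P [/(_ ord0)/and3P[pp /eqP pl _] _]].
by apply/connectP; exists (P ord0).
Qed.

(** * Sharpness of the bound *)

Lemma HL_sharp n r (G : sgraph) : HL n G -> 0 < r < n ->
  exists F : {set {set G}},
    [/\ F \subset edges G, #|F| + n.-1 = 2 ^ r * (n - r),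
        r <= min_deg (del_edges F) & ~ SM_lambda (del_edges F)].
Proof.
move=> hG /andP[r0 rn]; have [A [cA dA oA]] := HL_subcube hG (ltnW rn).
have outA x : x \in A -> ndeg (~: A) x = n - r.
  by move=> xA; rewrite -(HL_deg hG x) (degC A) dA // addKn.
have cbd : #|boundary A| = 2 ^ r * (n - r).
  rewrite card_boundary ecountE (eq_bigr (fun=> n - r)) ?sum_nat_const ?cA //.
have [u uA] : exists u, u \in A by apply/card_gt0P; rewrite cA expn_gt0.
have [v] : exists v, v \in [set y in ~: A | adj u y].
  by apply/card_gt0P; rewrite -ndegE outA // subn_gt0.
rewrite !inE => /andP[vA uv].
(* The boundary edges at [u] are to be kept; being at most [n - r], they fit among the [n.-1]
   survivors because [r > 0]. *)
pose Eu := [set e in boundary A | u \in e].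
have cEu : #|Eu| <= n - r.
  rewrite -(outA u uA) ndegE.
  apply: leq_trans (leq_imset_card (fun y => [set u; y]) _).
  apply/subset_leq_card/subsetP => e; rewrite inE => /andP[/boundaryP[x [y []]]].
  move=> -> xA yA xy; rewrite !inE => /orP[] /eqP e1; last first.
    by rewrite e1 (negPf yA) in uA.
  by apply/imsetP; exists y; rewrite ?inE ?yA e1.
(* One edge more than the claimed tolerance is deleted. *)
have [|F FA cF] := @subset_of_card _ (boundary A :\: Eu) (2 ^ r * (n - r) - n.-1).
  have := subset_leq_card (subsetIr (boundary A) Eu); rewrite cardsD cbd; lia.
have [Fbd nFu] : F \subset boundary A /\ forall e : {set G}, u \in e -> e \notin F.
  split; first by apply: subset_trans FA (subsetDl _ _).
  move=> e ue; apply/negP => /(subsetP FA); rewrite !inE ue andbT.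
  by case: (e \in _).
have cF' : #|F| + n.-1 = 2 ^ r * (n - r).
  (* The subtraction is not truncated: [r < 2 ^ r] gives [n <= 2 ^ r * (n - r)]. *)
  rewrite cF subnK //; have := ltn_expl r (isT : 1 < 2).
  by move: (2 ^ r) => T; nia.
have sameside x y : (x \in A) = (y \in A) -> [set x; y] \notin F.
  by move=> xy; apply/negP => /(subsetP Fbd); rewrite mem_boundary xy eqxx andbF.
exists F; split=> //; first exact: subset_trans Fbd (boundary_edges A).
  apply/leq_min_deg; split=> [|x].
    by apply: leq_trans (max_card (mem A)); rewrite cA ltnW // ltn_expl.
  have [xA|xA] := boolP (x \in A).
    rewrite (degC (A : {set del_edges F})) ndeg_del ?dA ?leq_addr //.
    by move=> y yA; apply: sameside; rewrite xA yA.
  (* A vertex outside [A] loses at most its single edge to [A] and keeps degree at least [n.-1]. *)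
  rewrite (degC (A : {set del_edges F})) (@ndeg_del _ _ (~: A)).
    by have := oA x xA; have := HL_deg hG x; rewrite (degC A); lia.
  by move=> y; rewrite inE => yA; apply: sameside; rewrite (negPf xA) (negPf yA).
have degu : deg (u : del_edges F) = n.
  rewrite degE ndeg_del -?degE ?(HL_deg hG) // => y _.
  by apply: nFu; rewrite !inE eqxx.
have degv : deg (v : del_edges F) = n.
  rewrite degE ndeg_del -?degE ?(HL_deg hG) // => y _.
  apply/negP => /[dup] /(subsetP Fbd); rewrite mem_boundary (negPf vA) => /andP[vy].
  case yA: (y \in A) => // _; apply/negP; apply: nFu.
  (* [u] is the only neighbour of [v] in [A], so the only boundary edge at [v] contains [u] and is
     kept. *)
  have := oA v vA; rewrite ndegE => /card_le1_eqP/(_ u y).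
  by rewrite !inE uA yA vy adj_sym uv => <- //; rewrite eqxx orbT.
have neq_uv : u != v by apply: contraNneq vA => <-.
case=> _ /(_ u v neq_uv); rewrite degu degv minnn => P.
have : n <= #|boundary A :\: F|.
  rewrite -boundary_del.
  exact: (@edge_disjoint_le_boundary (del_edges F) A u v n P uA vA).
rewrite cardsD (setIidPr Fbd) cbd; lia.
Qed.

Theorem theorem3p2 (n r : nat) (hn : 3 <= n) (hr1 : 1 <= r) (hr2 : r <= n - 2)
    (G : sgraph) (hG : HL n G) :
  is_sm_lambda r G (2%:Z ^+ r * (n%:Z - r%:Z) - n%:Z)%R.
Proof.
have -> : (2%:Z ^+ r * (n%:Z - r%:Z) = (2 ^ r * (n - r))%N%:Z)%R.
  by rewrite PoszM subzn; [rewrite -[Posz (2 ^ r)]natz natrX | lia].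
split=> [F FG Fm|m tol].
  by apply: (HL_del_SM hG hr1); lia.
have [|F [FG cF rF nSM]] := @HL_sharp n r G hG; first by lia.
(* Any integer above the stated value is at least [#|F|], so it would have to tolerate [F]. *)
rewrite leNgt; apply/negP => m_gt; apply: nSM; apply: tol => //.
lia.
Qed.
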